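(* Let $n>1$, let $S=\{o_1,\dots,o_n\}$ be a set of OIE instances, where $o_i$ is mapped to an event $e_i$ which corresponds bijectively to an operand symbol $p_i$ (the $p_1,\dots,p_n$ being distinct), and let $\odot$ be an $n$-ary finitary operator symbol. Let $*$ be either $\oplus|_\alpha^\beta$ (for fixed reals $\alpha<\beta$) or $\otimes$, and let $\mathcal O(S,* )$ be its orbit space. Then for each equivalence class in $\mathcal O(S,* )$ of non-void results, all results of $*$ on $S$ belonging to that class yield the same set of $n$-ary operation expressions under the projection based on ending timestamps. That is, if $\sigma=(i_1,\dots,i_n)$ and $\tau=(j_1,\dots,j_n)$ are index tuples such that $r_1=*(o_{i_1},\dots,o_{i_n})$ and $r_2=*(o_{j_1},\dots,o_{j_n})$ are non-void and $r_1\sim r_2$, then the sets of expressions $\mathrm{Op}(\sigma)$ and $\mathrm{Op}(\tau)$ obtained by the projection from $r_1$ and $r_2$ are equal.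
   Context: Times are real numbers; a ''2-tuple'' is a pair $(x,y)$ of reals with $x<y$ (starting and ending timestamp). For a nonempty finite tuple of 2-tuples $T=((x_1,y_1),\dots,(x_m,y_m))$ put $\mathrm{bound}(T)=(\min_i x_i,\max_i y_i)$. An OIE (Optional Intervals Event) instance is a 4-tuple $o=(\mathcal C_o,\mathcal F_o,\mathcal I_o,\mathcal A_o)$ where $\mathcal C_o$ is a finite (possibly empty) tuple of OIE instances, $\mathcal F_o$ is a set of nonempty finite tuples of 2-tuples, $\mathcal I_o=\{\mathrm{bound}(T):T\in\mathcal F_o\}$, and $\mathcal A_o$ is a set of (labels of) atomic events. The void instance is $o_{\mathrm{void}}=((),\emptyset,\emptyset,\emptyset)$; every other instance has $\mathcal F_o,\mathcal I_o,\mathcal A_o$ nonempty. Two instances are equal iff all four components are equal. An index tuple of length $n$ is a tuple in which each of $1,\dots,n$ occurs exactly once. A permutation matrix $M$ acts on $n$-tuples (viewed as row vectors) on the right by reordering the entries, $T\mapsto T\cdot M$. For $S=\{o_1,\dots,o_n\}$ and an index tuple $\sigma=(i_1,\dots,i_n)$, let $N(S,\sigma)=\{(t_1,\dots,t_n): t_k\in\mathcal I_{o_{i_k}}\text{ for all }k\}$. External constraints determine an infeasible subset $\mathrm{Inf}(S,\sigma)\subseteq N(S,\sigma)$; this is given data, subject only to the standing axiom: whenever $\sigma\cdot M=\tau$ for index tuples $\sigma,\tau$ of length $n>1$ and a permutation matrix $M$, the map $T\mapsto T\cdot M$ is a bijection from $\mathrm{Inf}(S,\sigma)$ onto $\mathrm{Inf}(S,\tau)$.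 Put $\mathrm{Feas}(S,\sigma)=N(S,\sigma)\setminus\mathrm{Inf}(S,\sigma)$. Domain filter: for a nonempty set $X$ of $n$-tuples of 2-tuples and reals $\alpha<\beta$, let $X'=\{T\in X: x\ge\alpha\text{ and }y\le\beta\text{ for every entry }(x,y)\text{ of }T\}$. Then $\mathrm{Dom}_\alpha^\beta(X)=X'$ if for every $k\in\{1,\dots,n\}$ some $T\in X'$ has $k$-th entry with first item $\alpha$ and some $T\in X'$ has $k$-th entry with second item $\beta$; otherwise $\mathrm{Dom}_\alpha^\beta(X)=\emptyset$. Ascending filter: for a set $X$ of tuples of 2-tuples, $\mathrm{Asc}(X)$ is the set of $T\in X$ such that for all positions $p<q$ the second item of the $p$-th entry of $T$ is $\le$ the first item of the $q$-th entry of $T$. Complete Sequence Addition $\oplus|_\alpha^\beta(o_{i_1},\dots,o_{i_n})$ and Complete Sequence Multiplication $\otimes(o_{i_1},\dots,o_{i_n})$, with $\sigma=(i_1,\dots,i_n)$: write $\Phi=\mathrm{Dom}_\alpha^\beta$ for $\oplus|_\alpha^\beta$ and $\Phi=\mathrm{Asc}$ for $\otimes$. The result is $o_{\mathrm{void}}$ if $\bigcap_{k}\mathcal A_{o_{i_k}}\ne\emptyset$, or some $o_{i_k}=o_{\mathrm{void}}$, or $\mathrm{Feas}(S,\sigma)=\emptyset$, or $\Phi(\mathrm{Feas}(S,\sigma))=\emptyset$. Otherwise the result is $(\mathcal C,\mathcal F,\mathcal I,\mathcal A)$ with $\mathcal C=(o_{i_1},\dots,o_{i_n})$, $\mathcal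 F=\Phi(\mathrm{Feas}(S,\sigma))$, $\mathcal I=\{\mathrm{bound}(T):T\in\mathcal F\}$, $\mathcal A=\bigcup_k\mathcal A_{o_{i_k}}$. Permutational equivalence $\sim$: two non-void instances $o,o'$ satisfy $o\sim o'$ if there is a permutation matrix $M$ such that $\mathcal C_o\cdot M=\mathcal C_{o'}$, $T\mapsto T\cdot M$ is a bijection from $\mathcal F_o$ onto $\mathcal F_{o'}$, $\mathcal I_o=\mathcal I_{o'}$ and $\mathcal A_o=\mathcal A_{o'}$. By convention $o_{\mathrm{void}}\sim o_{\mathrm{void}}$, and $o_{\mathrm{void}}$ is equivalent to no non-void instance. The orbit space $\mathcal O(S,* )$ is the set of $\sim$-equivalence classes of the results $*(o_{i_1},\dots,o_{i_n})$ over all index tuples $(i_1,\dots,i_n)$ of length $n$. Projection based on ending timestamps. Let $r=*(o_{i_1},\dots,o_{i_n})$ be non-void, $\sigma=(i_1,\dots,i_n)$. For $T=((x_1,y_1),\dots,(x_n,y_n))\in\mathcal F_r$, the $k$-th entry is attached to the operand $p_{i_k}$. Let $t_1<\dots<t_\lambda$ be the distinct values among $y_1,\dots,y_n$ and let $G_\theta=\{p_{i_k}: y_k=t_\theta\}$. The expressions generated by $T$ are all formal expressions $\odot(q_1,\dots,q_n)$ in which $(q_1,\dots,q_n)$ is a concatenation of an arbitrary ordering of $G_1$, then an arbitrary ordering of $G_2$, ..., then an arbitrary ordering of $G_\lambda$. The set $\mathrm{Op}(\sigma)$ is the union over all $T\in\mathcal F_r$ of the sets of expressions generated by $T$; two expressions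 are identified only if they have the same sequence of operands. The projection is undefined when the result is void. *)

(* Defs.v *)
(* All sets are classical sets, so two instances are
   equal (Leibniz) iff their four components are equal. *)
From HB Require Import structures.
From mathcomp Require Import all_boot all_order all_algebra all_fingroup.
From mathcomp Require Import boolp classical_sets functions reals.

Set Implicit Arguments.
Unset Strict Implicit.
Unset Printing Implicit Defensive.

Import Order.TTheory GRing.Theory Num.Theory.

Local Open Scope classical_set_scope.
Local Open Scope ring_scope.

(* Times are the elements of R.  A 2-tuple (starting, ending timestamp) is a
   pair p satisfying [two_tuple p]. *)
Definition two_tuple (R : realType) (p : R * R) : bool := p.1 < p.2.

(* The seeds of the iterated min and max are entries of T, so they do not
   affect the value on a nonempty T; the value on [::] is irrelevant. *)
Definition bound (R : realType) (T : seq (R * R)) : R * R :=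
  (\big[Num.min/(head (0, 0) T).1]_(t <- T) t.1,
   \big[Num.max/(head (0, 0) T).2]_(t <- T) t.2).

(* Raw 4-tuples (C, F, I, A); the conditions defining OIE instances are in
   [is_oie]. *)
Inductive oie (R : realType) (L : Type) : Type :=
  OIE of seq (oie R L) & set (seq (R * R)) & set (R * R) & set L.

Definition oie_C (R : realType) (L : Type) (o : oie R L) :=
  let: OIE C _ _ _ := o in C.
Definition oie_F (R : realType) (L : Type) (o : oie R L) :=
  let: OIE _ F _ _ := o in F.
Definition oie_I (R : realType) (L : Type) (o : oie R L) :=
  let: OIE _ _ J _ := o in J.
Definition oie_A (R : realType) (L : Type) (o : oie R L) :=
  let: OIE _ _ _ A := o in A.

Definition oie_void (R : realType) (L : Type) : oie R L :=
  OIE [::] set0 set0 set0.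

(* In the second case I is nonempty because F is. *)
Inductive is_oie (R : realType) (L : Type) : oie R L -> Prop :=
| is_oie_void : is_oie (oie_void R L)
| is_oie_event (C : seq (oie R L)) (F : set (seq (R * R))) (A : set L) of
    (forall i, (i < size C)%N -> is_oie (nth (oie_void R L) C i)) &
    (forall T, F T -> T != [::] /\ all (@two_tuple R) T) &
    F !=set0 & A !=set0 :
    is_oie (OIE C F (@bound R @` F) A).

Definition index_tuple (n : nat) (sigma : n.-tuple 'I_n) : bool :=
  [forall i, count_mem i sigma == 1%N].

(* T . M for the permutation matrix M = perm_mx s and the n-tuple T viewed as a
   row vector: entry i of T moves to position s i, see [permuteE]. *)
Definition permute (n : nat) (X : Type) (s : 'S_n) (T : n.-tuple X) :
    n.-tuple X :=
  [tuple tnth T ((s^-1)%g k) | k < n].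

Lemma permuteE (K : pzSemiRingType) (n : nat) (s : 'S_n) (T : n.-tuple K) :
  \row_k tnth (permute s T) k = (\row_k tnth T k) *m perm_mx s.
Proof.
rewrite -[s in RHS]invgK -col_permE; apply/rowP => k.
by rewrite !mxE tnth_mktuple.
Qed.

Definition Nset (R : realType) (L : Type) (n : nat) (o : 'I_n -> oie R L)
    (sigma : n.-tuple 'I_n) : set (n.-tuple (R * R)) :=
  [set T | forall k, oie_I (o (tnth sigma k)) (tnth T k)].

(* Admissible infeasible subsets for S = {o_1, ..., o_n}. *)
Definition infeasible_data (R : realType) (L : Type) (n : nat)
    (o : 'I_n -> oie R L)
    (Inf : n.-tuple 'I_n -> set (n.-tuple (R * R))) : Prop :=
  (forall sigma, index_tuple sigma -> Inf sigma `<=` Nset o sigma) /\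
  (forall sigma tau (s : 'S_n), index_tuple sigma -> index_tuple tau ->
     permute s sigma = tau -> set_bij (Inf sigma) (Inf tau) (permute s)).

Definition Feas (R : realType) (L : Type) (n : nat) (o : 'I_n -> oie R L)
    (Inf : n.-tuple 'I_n -> set (n.-tuple (R * R))) (sigma : n.-tuple 'I_n) :
    set (n.-tuple (R * R)) :=
  Nset o sigma `\` Inf sigma.

Definition dom_filter (R : realType) (n : nat) (alpha beta : R)
    (X : set (n.-tuple (R * R))) : set (n.-tuple (R * R)) :=
  let X' := [set T | X T /\
               forall k, alpha <= (tnth T k).1 /\ (tnth T k).2 <= beta] in
  if `[< forall k : 'I_n, (exists2 T, X' T & (tnth T k).1 = alpha) /\
                          (exists2 T, X' T & (tnth T k).2 = beta) >]
  then X' else set0.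

Definition asc_filter (R : realType) (n : nat) (X : set (n.-tuple (R * R))) :
    set (n.-tuple (R * R)) :=
  [set T | X T /\
     forall p q : 'I_n, (p < q)%N -> (tnth T p).2 <= (tnth T q).1].

(* Complete sequence addition on (alpha, beta), complete sequence
   multiplication. *)
Variant operation (R : realType) : Type :=
| SeqAdd (alpha beta : R) of alpha < beta
| SeqMul.
Arguments SeqMul {R}.

Definition op_filter (R : realType) (n : nat) (star : operation R) :
    set (n.-tuple (R * R)) -> set (n.-tuple (R * R)) :=
  match star with
  | SeqAdd alpha beta _ => dom_filter alpha beta
  | SeqMul => @asc_filter R n
  end.

Definition op_result (R : realType) (L : Type) (n : nat) (star : operation R)
    (o : 'I_n -> oie R L) (Inf : n.-tuple 'I_n -> set (n.-tuple (R * R)))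
    (sigma : n.-tuple 'I_n) : oie R L :=
  if `[< [\/ \bigcap_(k in [set: 'I_n]) oie_A (o (tnth sigma k)) !=set0,
             exists k, o (tnth sigma k) = oie_void R L,
             Feas o Inf sigma = set0 |
             op_filter star (Feas o Inf sigma) = set0] >]
  then oie_void R L
  else let F := [set tval T | T in op_filter star (Feas o Inf sigma)] in
       OIE [seq o i | i <- sigma] F (@bound R @` F)
         (\bigcup_(k in [set: 'I_n]) oie_A (o (tnth sigma k))).

(* The equation C . M = C' and the map T |-> T . M from F to F' presuppose that
   C, C' and the members of F, F' are n-tuples, n the size of M. *)
Definition perm_equiv_by (R : realType) (L : Type) (n : nat) (s : 'S_n)
    (r r' : oie R L) : Prop :=
  exists (C C' : n.-tuple (oie R L)) (X X' : set (n.-tuple (R * R))),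
    [/\ oie_C r = tval C /\ oie_C r' = tval C',
        oie_F r = [set tval T | T in X] /\ oie_F r' = [set tval T | T in X'],
        permute s C = C',
        set_bij X X' (permute s) &
        oie_I r = oie_I r' /\ oie_A r = oie_A r'].

Definition perm_equiv (R : realType) (L : Type) (r r' : oie R L) : Prop :=
  (r = oie_void R L /\ r' = oie_void R L) \/
  [/\ r <> oie_void R L, r' <> oie_void R L &
      exists (n : nat) (s : 'S_n), perm_equiv_by s r r'].

Definition op_results (R : realType) (L : Type) (n : nat) (star : operation R)
    (o : 'I_n -> oie R L) (Inf : n.-tuple 'I_n -> set (n.-tuple (R * R))) :
    set (oie R L) :=
  [set op_result star o Inf sigma | sigma in [set sigma | index_tuple sigma]].

Definition orbit_space (R : realType) (L : Type) (n : nat) (star : operation R)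
    (o : 'I_n -> oie R L) (Inf : n.-tuple 'I_n -> set (n.-tuple (R * R))) :
    set (set (oie R L)) :=
  [set [set r' | op_results star o Inf r' /\ perm_equiv r r'] |
     r in op_results star o Inf].

(* Formal n-ary expressions with operator symbols in Op, operand symbols in
   P. *)
Inductive expression (Op P : Type) (n : nat) : Type :=
  Expr of Op & n.-tuple P.

Definition end_times (R : realType) (n : nat) (T : n.-tuple (R * R)) : seq R :=
  sort <=%R (undup [seq t.2 | t <- T]).

Definition end_group (R : realType) (P : eqType) (n : nat) (p : 'I_n -> P)
    (sigma : n.-tuple 'I_n) (T : n.-tuple (R * R)) (t : R) : set P :=
  [set p (tnth sigma k) | k in [set k | (tnth T k).2 = t]].

Definition is_ordering (P : eqType) (G : set P) (q : seq P) : Prop :=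
  uniq q /\ [set` q] = G.

Definition generated_exprs (R : realType) (Op : Type) (P : eqType) (n : nat)
    (odot : Op) (p : 'I_n -> P) (sigma : n.-tuple 'I_n)
    (T : n.-tuple (R * R)) : set (expression Op P n) :=
  [set Expr odot q | q in [set q : n.-tuple P | exists qs : seq (seq P),
     [/\ tval q = flatten qs,
         size qs = size (end_times T) &
         forall theta, (theta < size qs)%N ->
           is_ordering (end_group p sigma T (nth 0 (end_times T) theta))
                       (nth [::] qs theta)]]].

(* Op(sigma) for r the result of the operation on (o_i | i <- sigma).  The
   projection is only meaningful when r is not void. *)
Definition projection (R : realType) (L Op : Type) (P : eqType) (n : nat)
    (odot : Op) (p : 'I_n -> P) (sigma : n.-tuple 'I_n) (r : oie R L) :
    set (expression Op P n) :=
  \bigcup_(T in [set T : n.-tuple (R * R) | oie_F r (tval T)])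
    generated_exprs odot p sigma T.

(* Main.v *)
Require Import Defs.
From HB Require Import structures.
From mathcomp Require Import all_boot all_order all_algebra all_fingroup.
From mathcomp Require Import boolp classical_sets functions reals.

(** Why the theorem holds.  The operation expressions generated by a tuple [T]
    of intervals depend on the operand sequence [sigma] and on [T] only through
    the unordered collection of pairs (operand, interval attached to it):
    neither the sorted list of distinct ending times nor the set of operands
    ending at a given time sees the order of the positions.  Hence
    [generated_exprs] is unchanged when [sigma] and [T] are reordered by one
    and the same permutation ([generated_exprs_permute]).

    It remains to see that an equivalence between two results supplies such a
    simultaneous reordering.  Its permutation [s] carries the components
    [(o_i | i <- sigma)] of the first result to the components
    [(o_j | j <- tau)] of the second; the [o_i] being pairwise distinct, [s]
    carries [sigma] itself to [tau].  The same [s] maps the first set of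
    interval tuples bijectively onto the second, so the two projections are
    unions of the same sets of expressions ([projection_perm_equiv]).  Two
    results in one class are both equivalent to the representative defining
    the class, so each has the same projection as that representative. *)

Set Implicit Arguments.
Unset Strict Implicit.
Unset Printing Implicit Defensive.

Import Order.TTheory.

Local Open Scope classical_set_scope.
Local Open Scope ring_scope.

Lemma tnth_permute (n : nat) (X : Type) (s : 'S_n) (T : n.-tuple X) k :
  tnth (permute s T) (s k) = tnth T k.
Proof. by rewrite tnth_mktuple permK. Qed.

Lemma permute_map_tuple (n : nat) (X Y : Type) (f : X -> Y) (s : 'S_n)
    (T : n.-tuple X) :
  permute s (map_tuple f T) = map_tuple f (permute s T).
Proof. by apply: eq_from_tnth => k; rewrite !(tnth_map, tnth_mktuple). Qed.

Lemma map_tuple_inj (n : nat) (X Y : Type) (f : X -> Y) :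
  injective f -> injective (@map_tuple n X Y f).
Proof.
move=> f_inj T U /(congr1 val) /= eq_map.
by apply: val_inj; apply: inj_map eq_map.
Qed.

Lemma perm_eq_permute (n : nat) (X : eqType) (s : 'S_n) (T : n.-tuple X) :
  perm_eq (permute s T) T.
Proof. by apply/tuple_permP; exists (s^-1)%g. Qed.

(** A sorted duplicate-free list is determined by its set of entries. *)
Lemma end_times_permute (R : realType) (n : nat) (s : 'S_n)
    (T : n.-tuple (R * R)) :
  end_times (permute s T) = end_times T.
Proof.
apply/perm_sort_leP; apply: perm_undup; apply: perm_mem.
exact/perm_map/perm_eq_permute.
Qed.

Lemma end_group_permute (R : realType) (P : eqType) (n : nat) (p : 'I_n -> P)
    (s : 'S_n) (sigma : n.-tuple 'I_n) (T : n.-tuple (R * R)) (t : R) :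
  end_group p (permute s sigma) (permute s T) t = end_group p sigma T t.
Proof.
apply/seteqP; split=> _ [k /= <- <-].
  by exists ((s^-1)%g k); rewrite //= ?tnth_mktuple.
by exists (s k); rewrite /= ?tnth_permute.
Qed.

(** Reordering the operands together with their intervals keeps each operand
    attached to its own interval, which is all that the expressions record. *)
Lemma generated_exprs_permute (R : realType) (Op : Type) (P : eqType) (n : nat)
    (odot : Op) (p : 'I_n -> P) (s : 'S_n) (sigma : n.-tuple 'I_n)
    (T : n.-tuple (R * R)) :
  generated_exprs odot p (permute s sigma) (permute s T) =
  generated_exprs odot p sigma T.
Proof.
rewrite /generated_exprs end_times_permute.
suff -> : end_group p (permute s sigma) (permute s T) = end_group p sigma T by [].
by apply/funext => t; apply: end_group_permute.
Qed.

Lemma oie_C_op_result (R : realType) (L : Type) (n : nat) (star : operation R)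
    (o : 'I_n -> oie R L) (Inf : n.-tuple 'I_n -> set (n.-tuple (R * R)))
    (sigma : n.-tuple 'I_n) :
  op_result star o Inf sigma <> oie_void R L ->
  oie_C (op_result star o Inf sigma) = map_tuple o sigma.
Proof. by rewrite /op_result; case: ifP. Qed.

(** The components determine the operand sequence because the [o_i] are
    pairwise distinct; this turns a permutation of the components into a
    permutation of the operands. *)
Lemma projection_perm_equiv (R : realType) (L : Type) (n : nat)
    (o : 'I_n -> oie R L) (o_inj : injective o) (Op : Type) (P : eqType)
    (odot : Op) (p : 'I_n -> P) (s : 'S_n) (sigma tau : n.-tuple 'I_n)
    (r r' : oie R L) :
  oie_C r = map_tuple o sigma -> oie_C r' = map_tuple o tau ->
  perm_equiv_by s r r' ->
  projection odot p sigma r = projection odot p tau r'.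
Proof.
move=> rC r'C [C [C' [X [X' [[]]]]]].
rewrite rC r'C => /val_inj <- /val_inj <- [rF r'F].
rewrite permute_map_tuple => /(map_tuple_inj o_inj) <- [sX _ sX'] _.
have FE (Y : set (n.-tuple (R * R))) T : [set tval U | U in Y] (tval T) <-> Y T.
  by split=> [[U YU /val_inj <-] | YT] //; exists T.
apply/seteqP; split=> e [T /=].
- rewrite rF => /FE XT eT; exists (permute s T).
    by rewrite /mkset r'F; apply/FE/sX.
  by rewrite generated_exprs_permute.
- rewrite r'F => /FE /sX' [U XU <-]; rewrite generated_exprs_permute => eU.
  by exists U => //=; rewrite rF; apply/FE.
Qed.

(** The size of the permutation in the definition of the equivalence is forced
    to be the common number of components. *)
Lemma projection_op_result (R : realType) (L : Type) (n : nat)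
    (star : operation R) (o : 'I_n -> oie R L) (o_inj : injective o)
    (Inf : n.-tuple 'I_n -> set (n.-tuple (R * R))) (Op : Type) (P : eqType)
    (odot : Op) (p : 'I_n -> P) (sigma tau : n.-tuple 'I_n) :
  op_result star o Inf sigma <> oie_void R L ->
  op_result star o Inf tau <> oie_void R L ->
  perm_equiv (op_result star o Inf sigma) (op_result star o Inf tau) ->
  projection odot p sigma (op_result star o Inf sigma) =
  projection odot p tau (op_result star o Inf tau).
Proof.
move=> nv_sigma nv_tau [[]// | [_ _ [m [s eqv]]]].
have Csigma := oie_C_op_result nv_sigma.
have Ctau := oie_C_op_result nv_tau.
have mn : m = n.
  case: eqv => C [C' [X [X' [[/(congr1 size) + _] _ _ _ _]]]].
  by rewrite Csigma !size_tuple.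
subst m; exact: (projection_perm_equiv o_inj odot p Csigma Ctau eqv).
Qed.

Theorem corollary1 (R : realType) (L : Type) (n : nat) (hn : (1 < n)%N)
    (o : 'I_n -> oie R L) (o_oie : forall i, is_oie (o i))
    (o_inj : injective o)
    (Inf : n.-tuple 'I_n -> set (n.-tuple (R * R)))
    (hInf : infeasible_data o Inf)
    (Event : Type) (P : eqType) (event : 'I_n -> Event) (symb : Event -> P)
    (p_inj : injective (fun i => symb (event i)))
    (Op : Type) (odot : Op) (star : operation R) :
  let p := fun i => symb (event i) in
  (forall K : set (oie R L), orbit_space star o Inf K ->
     (forall r, K r -> r <> oie_void R L) ->
     forall sigma tau : n.-tuple 'I_n, index_tuple sigma -> index_tuple tau ->
       K (op_result star o Inf sigma) -> K (op_result star o Inf tau) ->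
       projection odot p sigma (op_result star o Inf sigma) =
       projection odot p tau (op_result star o Inf tau)) /\
  (forall sigma tau : n.-tuple 'I_n, index_tuple sigma -> index_tuple tau ->
     op_result star o Inf sigma <> oie_void R L ->
     op_result star o Inf tau <> oie_void R L ->
     perm_equiv (op_result star o Inf sigma) (op_result star o Inf tau) ->
     projection odot p sigma (op_result star o Inf sigma) =
     projection odot p tau (op_result star o Inf tau)).
Proof.
move=> p.
have two (sigma tau : n.-tuple 'I_n) :=
  @projection_op_result R L n star o o_inj Inf Op P odot p sigma tau.
split=> [K [_ [rho _ <-] <-] K_nv sigma tau _ _ Ksigma Ktau | sigma tau _ _];
  last exact: two.
have nv_sigma := K_nv _ Ksigma; have nv_tau := K_nv _ Ktau.
case: Ksigma Ktau => _ eqv_sigma [_ eqv_tau].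
(* Equivalence to a non-void result excludes a void representative. *)
have nv_rho : op_result star o Inf rho <> oie_void R L.
  by case: eqv_sigma => [[_ /nv_sigma] | []].
by rewrite -(two _ _ nv_rho nv_sigma eqv_sigma) (two _ _ nv_rho nv_tau eqv_tau).
Qed.
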